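(* On the ground set $[6]=\{1,\dots,6\}$, with complements taken in $[6]$, let $$\mathcal{A}'_6 := \{\{1,2\}^c, \{3,4\}^c, \{5,6\}^c, \emptyset\}, \qquad \mathcal{B}'_6 := \{\{2,3\}^c, \{4,5\}^c, \{6,1\}^c, \emptyset\}.$$ Then $(\mathcal{A}'_6,\mathcal{B}'_6)$ is a recovering pair, and $$\sum_{A \in \mathcal{A}'_6,\; B \in \mathcal{B}'_6} 2^{|A \cap B|} = 67 > 64 = 2^6.$$ In particular it is not true that $\sum_{A\in\mathcal{A},\,B\in\mathcal{B}} 2^{|A\cap B|}\le 2^n$ for every recovering pair $(\mathcal{A},\mathcal{B})$ on an $n$ element ground set (the answer to Aharoni's question is negative).
   Context: A pair $(\mathcal{A},\mathcal{B})$ of set systems (families of subsets) on an $n$ element ground set is called a recovering pair if for every $A,A' \in \mathcal{A}$ and $B,B' \in \mathcal{B}$: ($A \setminus B = A' \setminus B'$ implies $A=A'$) and ($B \setminus A = B' \setminus A'$ implies $B=B'$). Aharoni's question asks whether $\sum_{A\in\mathcal{A},\,B\in\mathcal{B}} 2^{|A\cap B|}\le 2^n$ holds for every recovering pair on an $n$ element ground set. *)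

(* Defs.v *)
From mathcomp Require Import all_boot.

Set Implicit Arguments.
Unset Strict Implicit.
Unset Printing Implicit Defensive.

Definition recovering (T : finType) (cA cB : {set {set T}}) : Prop :=
  forall A A' B B' : {set T},
    A \in cA -> A' \in cA -> B \in cB -> B' \in cB ->
    (A :\: B = A' :\: B' -> A = A') /\ (B :\: A = B' :\: A' -> B = B').

Definition inter_weight (T : finType) (cA cB : {set {set T}}) : nat :=
  \sum_(A in cA) \sum_(B in cB) 2 ^ #|A :&: B|.

(* An affirmative answer to Aharoni's question. *)
Definition aharoni : Prop :=
  forall (n : nat) (T : finType) (cA cB : {set {set T}}),
    #|T| = n -> recovering cA cB -> inter_weight cA cB <= 2 ^ n.

(* The ground set {1, ..., 6} is represented by 'I_6 = {0, ..., 5}: the label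
   k with 1 <= k <= 6 stands for the ordinal k - 1. *)
Definition pt (k : nat) : 'I_6 := inord k.-1.

Definition copair (i j : nat) : {set 'I_6} := ~: [set pt i; pt j].

Definition A6 : {set {set 'I_6}} :=
  [set copair 1 2; copair 3 4; copair 5 6; set0].

Definition B6 : {set {set 'I_6}} :=
  [set copair 2 3; copair 4 5; copair 6 1; set0].

(* Main.v *)
Require Import Defs.
From mathcomp Require Import all_boot.

(** Both systems are encoded by lists of characteristic bit vectors, on which
    the recovering property and the weight are decided by evaluation. *)

(** The six pairs are the alternating edges of a hexagon. If A and B are the complements of edges P
    and Q, then A \ B = Q \ P, a nonempty part of Q that determines both edges; this has size 1 or
    2, whereas an empty B gives size 4 and an empty A size 0. So A is recovered, and B by symmetry.
    Each P meets two of the Q in a point and misses the third, giving 3 * (8 + 8 + 4) = 60; the 7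
    pairs involving the empty set add 1 each. This finite check is run on bit vectors through
    [recovering_bitset] and [inter_weight_bitset]. *)

Definition bitset {n} (t : n.-tuple bool) : {set 'I_n} := [set i | tnth t i].

Definition bitmap2 {n} (f : bool -> bool -> bool) (t u : n.-tuple bool) :
    n.-tuple bool :=
  [tuple of [seq f p.1 p.2 | p <- zip t u]].

Lemma bitset_inj n : injective (@bitset n).
Proof.
by move=> t u /setP eq_tu; apply: eq_from_tnth => i; have := eq_tu i; rewrite !inE.
Qed.

Lemma tnth_bitmap2 n f (t u : n.-tuple bool) i :
  tnth (bitmap2 f t u) i = f (tnth t i) (tnth u i).
Proof. by rewrite tnth_map !(tnth_nth false) (tnth_nth (false, false)) nth_zip ?size_tuple. Qed.

Lemma bitset_setD n (t u : n.-tuple bool) :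
  bitset t :\: bitset u = bitset (bitmap2 (fun b c => ~~ c && b) t u).
Proof. by apply/setP => i; rewrite !inE tnth_bitmap2. Qed.

Lemma bitset_setI n (t u : n.-tuple bool) :
  bitset t :&: bitset u = bitset (bitmap2 andb t u).
Proof. by apply/setP => i; rewrite !inE tnth_bitmap2. Qed.

Lemma card_bitset n (t : n.-tuple bool) : #|bitset t| = count id t.
Proof.
rewrite -sum1_card -sum1_count big_tuple.
by apply: eq_bigl => i; rewrite inE.
Qed.

(** Injectivity of [bitset] turns equalities of sets into equalities of tuples, which are
    decidable. *)
Lemma recovering_bitset n (cA cB : {set {set 'I_n}}) (sA sB : seq (n.-tuple bool)) :
    cA =i map bitset sA -> cB =i map bitset sB ->
    let D := bitmap2 (fun b c => ~~ c && b) in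
    all (fun a => all (fun a' => all (fun b => all (fun b' =>
      ((D a b == D a' b') ==> (a == a')) && ((D b a == D b' a') ==> (b == b')))
      sB) sB) sA) sA ->
  recovering cA cB.
Proof.
move=> cAE cBE D chk A A' B B'; rewrite !cAE !cBE.
move=> /mapP[a sa ->] /mapP[a' sa' ->] /mapP[b sb ->] /mapP[b' sb' ->].
move: chk => /allP/(_ a sa)/allP/(_ a' sa')/allP/(_ b sb)/allP/(_ b' sb').
rewrite !bitset_setD => /andP[/implyP injA /implyP injB].
by split=> /bitset_inj/eqP => [/injA | /injB] /eqP->.
Qed.

Lemma inter_weight_bitset n (cA cB : {set {set 'I_n}}) (sA sB : seq (n.-tuple bool)) :
    cA =i map bitset sA -> cB =i map bitset sB -> uniq sA -> uniq sB ->
  inter_weight cA cB =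
  sumn [seq sumn [seq 2 ^ count id (bitmap2 andb a b) | b <- sB] | a <- sA].
Proof.
(* A list sum counts repetitions and a set sum does not, hence the [uniq] hypothesis. *)
have sum_bitset (cC : {set {set 'I_n}}) (sC : seq (n.-tuple bool)) F :
    cC =i map bitset sC -> uniq sC ->
    \sum_(C in cC) F C = \sum_(c <- sC) F (bitset c).
  move=> cCE uC; rewrite (eq_bigl _ _ cCE) -big_uniq ?big_map //.
  by rewrite map_inj_uniq //; apply: bitset_inj.
move=> cAE cBE uA uB; rewrite /inter_weight (sum_bitset _ _ _ cAE uA).
rewrite sumnE big_map; apply: eq_bigr => a _.
rewrite (sum_bitset _ _ _ cBE uB) sumnE big_map; apply: eq_bigr => b _.
by rewrite bitset_setI card_bitset.
Qed.

Definition copair_bits (i j : nat) : 6.-tuple bool :=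
  [tuple of [seq ~~ ((k == i) || (k == j)) | k <- iota 1 6]].

(** The bounds keep [pt] faithful: label 0 would collapse onto label 1, and [inord] sends anything
    too large to its default 0. *)
Lemma copairE i j :
  0 < i <= 6 -> 0 < j <= 6 -> copair i j = bitset (copair_bits i j).
Proof.
case: i j => [|i] [|j] //= ltj lti; apply/setP => k.
rewrite !inE -!val_eqE /= !inordK // (tnth_nth false).
by case: k => [[|[|[|[|[|[|k]]]]]] ltk].
Qed.

Lemma bitset_nseq0 n : bitset [tuple of nseq n false] = set0.
Proof. by apply/setP => i; rewrite !inE (tnth_nth false) nth_nseq if_same. Qed.

Definition A6_bits :=
  [:: copair_bits 1 2; copair_bits 3 4; copair_bits 5 6; [tuple of nseq 6 false]].

Definition B6_bits :=
  [:: copair_bits 2 3; copair_bits 4 5; copair_bits 6 1; [tuple of nseq 6 false]].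

Lemma A6E : A6 =i map bitset A6_bits.
Proof. by move=> X; rewrite /= bitset_nseq0 -!copairE // !inE -!orbA. Qed.

Lemma B6E : B6 =i map bitset B6_bits.
Proof. by move=> X; rewrite /= bitset_nseq0 -!copairE // !inE -!orbA. Qed.

Theorem corollary2 :
  [/\ recovering A6 B6,
      inter_weight A6 B6 = 67,
      64 < 67 /\ 64 = 2 ^ 6
    & ~ aharoni].
Proof.
have rec6 : recovering A6 B6.
  (* Evaluation over the 4^4 quadruples (A, A', B, B'). *)
  by apply: (recovering_bitset _ _ _ _ _ A6E B6E); vm_compute.
have weight6 : inter_weight A6 B6 = 67.
  by rewrite (inter_weight_bitset _ _ _ _ _ A6E B6E).
split=> // /(_ 6 'I_6 A6 B6 (card_ord 6) rec6).
by rewrite weight6.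
Qed.
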